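(* Let $(W,S)$ be a Coxeter system of universal type (i.e. $m_{st}=\infty$ for all $s\neq t\in S$) of finite rank at least $2$. Let $K\subseteq\mathbb{N}$ be non-empty and let $\mathcal{J}=(J_k)_{k\in K}$ be a family of subsets $J_k\subseteq\{1,\ldots,k\}$. Then there exist a Weyl-invariant commutator blueprint $\mathcal{M}=(M_{\alpha,\beta}^G)_{(G,\alpha,\beta)\in\mathcal{I}}$ of type $(W,S)$ and elements $s\neq t\in S$ such that the restriction of $\mathcal{M}$ to the $\{s,t\}$-residue $\langle s,t\rangle$ coincides with the commutator blueprint coming from Tits' construction of trivalent Moufang twin trees with parameters $(K,\mathcal{J})$, that is: for every $w\in\langle s,t\rangle$, every $G\in\mathrm{Min}(w)$ and all $\alpha,\beta\in\Phi(G)$ with $\alpha\leq_G\beta$ one has $M_{\alpha,\beta}^G=T(K,\mathcal{J},s,t)_{\alpha,\beta}^G$.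
   Context: Galleries and roots. Let $(W,S)$ be a Coxeter system of finite rank with length function $\ell$; $m_{st}$ is the order of $st$. Elements of $W$ are called chambers. A gallery is a sequence $(w_0,\ldots,w_n)$ of chambers with $s_i:=w_{i-1}^{-1}w_i\in S$; $(s_1,\ldots,s_n)$ is its type; it is minimal if $\ell(w_0^{-1}w_n)=n$. For $s\in S$ put $\alpha_s=\{w\in W\mid \ell(sw)>\ell(w)\}$. A root is a set $v\alpha_s$ with $v\in W,s\in S$; $\Phi$ is the set of roots, $\Phi_+$ the set of roots containing $1_W$, $-\alpha=W\setminus\alpha$. A pair $\{\alpha,\beta\}$ of roots is prenilpotent if $\alpha\cap\beta\neq\emptyset\neq(-\alpha)\cap(-\beta)$; then $[\alpha,\beta]=\{\gamma\in\Phi\mid\alpha\cap\beta\subseteq\gamma,\ (-\alpha)\cap(-\beta)\subseteq-\gamma\}$ and $(\alpha,\beta)=[\alpha,\beta]\setminus\{\alpha,\beta\}$. A minimal gallery $(c_0,\ldots,c_k)$ crosses the sequence of roots $(\alpha_1,\ldots,\alpha_k)$, where $\alpha_i$ is the unique root with $c_{i-1}\in\alpha_i$, $c_i\notin\alpha_i$; it is then called a minimal gallery between $\alpha_1$ and $\alpha_k$. $\mathrm{Min}$ is the set of minimal galleries starting at $1_W$, and $\mathrm{Min}(w)$ the set of those ending at $w$. For $w\in W$ with $\ell(sw)=\ell(w)-1$, $\mathrm{Min}_s(w)$ is the set of $G\in\mathrm{Min}(w)$ whose type begins with $s$; if $\ell(sw)=\ell(w)+1$, $\mathrm{Min}_s(w)=\mathrm{Min}(w)$.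 For $G=(c_0,\ldots,c_k)\in\mathrm{Min}_s(w)$ put $sG=(sc_1,\ldots,sc_k)$ if $\ell(sw)=\ell(w)-1$ and $sG=(1_W,sc_0,\ldots,sc_k)$ if $\ell(sw)=\ell(w)+1$. For $w\in W$ let $\Phi(w)=\{\alpha\in\Phi_+\mid w\notin\alpha\}$. For $G\in\mathrm{Min}$ crossing $(\alpha_1,\ldots,\alpha_k)$ let $\Phi(G)=\{\alpha_1,\ldots,\alpha_k\}$, ordered by $\alpha_1\leq_G\cdots\leq_G\alpha_k$ (so $\Phi(G)=\Phi(w)$ for $G\in\mathrm{Min}(w)$). Let $\mathcal{I}=\{(G,\alpha,\beta)\in\mathrm{Min}\times\Phi_+\times\Phi_+\mid\alpha,\beta\in\Phi(G),\ \alpha\leq_G\beta\}$. Given a family $(M_{\alpha,\beta}^G)_{(G,\alpha,\beta)\in\mathcal{I}}$ of subsets $M_{\alpha,\beta}^G\subseteq(\alpha,\beta)$ ordered via $\leq_G$, products $\prod_{\gamma\in M_{\alpha,\beta}^G}u_\gamma$ are taken in increasing order with respect to $\leq_G$, $[x,y]=x^{-1}y^{-1}xy$, and $U_w$ is the group with generators $u_\alpha$ ($\alpha\in\Phi(w)$) and relations $u_\alpha^2=1$ ($\alpha\in\Phi(w)$) and $[u_\alpha,u_\beta]=\prod_{\gamma\in M_{\alpha,\beta}^G}u_\gamma$ for all $(G,\alpha,\beta)\in\mathcal{I}$ with $G\in\mathrm{Min}(w)$. A commutator blueprint of type $(W,S)$ is such a family satisfying: (CB1) if $G=(c_0,\ldots,c_k)\in\mathrm{Min}$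 and $H=(c_0,\ldots,c_m)$ with $1\leq m\leq k$, then $M_{\alpha,\beta}^H=M_{\alpha,\beta}^G$ for all $\alpha\leq_H\beta$ in $\Phi(H)$; (CB2) if $s\neq t\in S$, $m_{st}<\infty$, and $(G,\alpha,\beta)\in\mathcal{I}$ with $G\in\mathrm{Min}(r_{\{s,t\}})$, where $r_{\{s,t\}}$ is the longest element of $\langle s,t\rangle$, then $M_{\alpha,\beta}^G=(\alpha,\beta)$ if $\{\alpha,\beta\}=\{\alpha_s,\alpha_t\}$ and $M_{\alpha,\beta}^G=\emptyset$ otherwise; (CB3) $|U_w|=2^{\ell(w)}$ for all $w\in W$. It is Weyl-invariant if $M_{s\alpha,s\beta}^{sG}=\{s\gamma\mid\gamma\in M_{\alpha,\beta}^G\}$ for all $w\in W$, $s\in S$, $G\in\mathrm{Min}_s(w)$ and $\alpha\leq_G\beta$ in $\Phi(G)\setminus\{\alpha_s\}$. Tits' commutator blueprint with parameters $(K,\mathcal{J})$. For $s\neq t\in S$, $w\in\langle s,t\rangle$, $G\in\mathrm{Min}(w)$ and $\alpha\leq_G\beta$ in $\Phi(G)$: if for some $k\in K$ there is a minimal gallery of type $(s,t,s,\ldots,t,s)$ (with $k+1$ entries $s$ and $k$ entries $t$) between $\alpha$ and $\beta$, crossing the sequence of roots $(\alpha_1=\alpha,\alpha_2,\ldots,\alpha_{2k+1}=\beta)$, then $T(K,\mathcal{J},s,t)_{\alpha,\beta}^G=\{\alpha_{2j}\mid j\in J_k\}$; otherwise $T(K,\mathcal{J},s,t)_{\alpha,\beta}^G=\emptyset$.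 *)

(* Defs.v *)
From HB Require Import structures.
From mathcomp Require Import all_boot.
From mathcomp Require Import boolp classical_sets functions cardinality.

Set Implicit Arguments.
Unset Strict Implicit.
Unset Printing Implicit Defensive.

Local Open Scope classical_set_scope.
Local Open Scope group_scope.
Local Open Scope quotient_scope.

(* The letter [(x, false)] stands for x and [(x, true)] for its inverse. *)
Definition word (X : Type) : Type := seq (X * bool).

Definition letters (X : Type) (l : seq X) : word X :=
  [seq (x, false) | x <- l].

Definition comm_word (X : Type) (x y : X) : word X :=
  [:: (x, true); (y, true); (x, false); (y, false)].

Definition word_inv (X : Type) (u : word X) : word X :=
  rev [seq (p.1, ~~ p.2) | p <- u].

Inductive word_eq (X : Type) (R : word X -> word X -> Prop) :
    word X -> word X -> Prop :=
| word_eq_refl u : word_eq R u u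
| word_eq_sym u v : word_eq R u v -> word_eq R v u
| word_eq_trans u v w : word_eq R u v -> word_eq R v w -> word_eq R u w
| word_eq_cat u u' v v' :
    word_eq R u u' -> word_eq R v v' -> word_eq R (u ++ v) (u' ++ v')
| word_eq_cancel x b : word_eq R [:: (x, b); (x, ~~ b)] [::]
| word_eq_rel u v : R u v -> word_eq R u v.

Section PresentedGroup.
Variables (X : choiceType) (R : word X -> word X -> Prop).

Let E (u v : seq (X * bool)) : bool := `[< word_eq R u v >].

Lemma E_is_equiv : equiv_class_of E.
Proof.
split=> [u|u v|v u w].
- by apply/asboolP; apply: word_eq_refl.
- by apply/asboolP/asboolP; apply: word_eq_sym.
- by move=> /asboolP uv /asboolP vw; apply/asboolP; apply: word_eq_trans uv vw.
Qed.

Canonical E_equiv := EquivRelPack E_is_equiv.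

Definition presented_group : Type := {eq_quot E_equiv}.

HB.instance Definition _ := Choice.on presented_group.

Definition pg_class (u : word X) : presented_group :=
  \pi_{eq_quot E_equiv} u.

Lemma pg_classP u v : pg_class u = pg_class v <-> word_eq R u v.
Proof. by split=> [/eqmodP/asboolP|uv]; last by apply/eqmodP/asboolP. Qed.

Lemma pg_class_surj (x : presented_group) : exists u, x = pg_class u.
Proof. by exists (repr (x : {eq_quot E_equiv})); rewrite /pg_class reprK. Qed.

Let rep (x : presented_group) : word X := repr (x : {eq_quot E_equiv}).

Let repP u : word_eq R (rep (pg_class u)) u.
Proof. by apply/pg_classP; rewrite /rep /pg_class reprK. Qed.

Definition pg_mul (x y : presented_group) := pg_class (rep x ++ rep y).
Definition pg_one := pg_class [::].
Definition pg_inv (x : presented_group) := pg_class (word_inv (rep x)).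

Lemma pg_class_cat u v : pg_mul (pg_class u) (pg_class v) = pg_class (u ++ v).
Proof. by apply/pg_classP; apply: word_eq_cat; apply: repP. Qed.

Let word_invV u : word_eq R (word_inv u ++ u) [::].
Proof.
elim: u => [|[x b] u IHu]; first exact: word_eq_refl.
rewrite /word_inv /= rev_cons cat_rcons.
apply: word_eq_trans IHu; apply: word_eq_cat; first exact: word_eq_refl.
rewrite -(cat1s _ u) -!cat_cons -[X in word_eq _ _ X]cat0s.
apply: word_eq_cat; last exact: word_eq_refl.
by rewrite -[X in (_, X) :: nil]negbK; apply: word_eq_cancel.
Qed.

Let word_invK : involutive (@word_inv X).
Proof.
move=> u; rewrite /word_inv map_rev revK -map_comp -[RHS]map_id.
by apply: eq_map => -[x b] /=; rewrite negbK.
Qed.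

Let word_inv_eq u v : word_eq R u v -> word_eq R (word_inv u) (word_inv v).
Proof.
move=> uv.
apply: (word_eq_trans (v := word_inv u ++ (v ++ word_inv v))).
  rewrite -[X in word_eq _ X _]cats0; apply: word_eq_cat.
    exact: word_eq_refl.
  by apply: word_eq_sym; rewrite -[X in X ++ _]word_invK; apply: word_invV.
rewrite catA -[X in word_eq _ _ X]cat0s.
apply: word_eq_cat; last exact: word_eq_refl.
apply: word_eq_trans (word_invV u).
by apply: word_eq_cat; [apply: word_eq_refl | apply: word_eq_sym].
Qed.

Lemma pg_class_inv u : pg_inv (pg_class u) = pg_class (word_inv u).
Proof. by apply/pg_classP/word_inv_eq/repP. Qed.

Lemma pg_mulA : associative pg_mul.
Proof.
move=> x y z; have [u ->] := pg_class_surj x; have [v ->] := pg_class_surj y.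
by have [w ->] := pg_class_surj z; rewrite !pg_class_cat catA.
Qed.

Lemma pg_mul1 : left_id pg_one pg_mul.
Proof. by move=> x; have [u ->] := pg_class_surj x; rewrite pg_class_cat. Qed.

Lemma pg_mulr1 : right_id pg_one pg_mul.
Proof.
by move=> x; have [u ->] := pg_class_surj x; rewrite pg_class_cat cats0.
Qed.

Lemma pg_mulV : left_inverse pg_one pg_inv pg_mul.
Proof.
move=> x; have [u ->] := pg_class_surj x; rewrite pg_class_inv pg_class_cat.
exact/pg_classP/word_invV.
Qed.

Lemma pg_mulrV : right_inverse pg_one pg_inv pg_mul.
Proof.
move=> x; have [u ->] := pg_class_surj x; rewrite pg_class_inv pg_class_cat.
by apply/pg_classP; rewrite -[X in X ++ _]word_invK; apply: word_invV.
Qed.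

HB.instance Definition _ :=
  isGroup.Build presented_group pg_mulA pg_mul1 pg_mulr1 pg_mulV pg_mulrV.

End PresentedGroup.

Arguments presented_group {X} R.

Definition word_eval (X : Type) (H : groupType) (f : X -> H) (u : word X) : H :=
  \prod_(p <- u) (if p.2 then (f p.1)^-1 else f p.1).

Definition is_presentation (X : Type) (H : groupType) (f : X -> H)
    (R : word X -> word X -> Prop) : Prop :=
  (forall h, exists u, word_eval f u = h) /\
  (forall u v, word_eval f u = word_eval f v <-> word_eq R u v).

Lemma presented_groupP (X : choiceType) (R : word X -> word X -> Prop) :
  is_presentation
    (fun x => pg_class R [:: (x, false)] : presented_group R) R.
Proof.
have evalE u : word_eval
    (fun x => pg_class R [:: (x, false)] : presented_group R) u = pg_class R u.
  rewrite /word_eval; elim: u => [|[x b] u IHu]; first by rewrite big_nil.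
  rewrite big_cons IHu -(cat1s _ u) -pg_class_cat; congr pg_mul.
  by case: b => //=; apply: pg_class_inv.
split=> [h|u v]; last by rewrite !evalE pg_classP.
by have [u ->] := pg_class_surj h; exists u; rewrite evalE.
Qed.

Definition generated (H : groupType) (A : set H) : set H :=
  [set h | exists u : word A, word_eval val u = h].

Definition least (P : set nat) : nat :=
  xget 0%N [set n | P n /\ forall m, P m -> (n <= m)%N].

(* Infinite order is encoded by 0. *)
Definition order_of (H : groupType) (x : H) : nat :=
  least [set n | (0 < n)%N /\ x ^+ n = 1].

Section Coxeter.
Variables (W : groupType) (S : set W).

(* For [order_of (s * t) = 0], i.e. m_st infinite, the relation is vacuous. *)
Definition coxeter_rel (u v : word S) : Prop :=
  exists s t : S,
    u = flatten (nseq (order_of (val s * val t)) (letters [:: s; t])) /\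
    v = [::].

Definition coxeter_system : Prop :=
  (forall s, S s -> order_of s = 2) /\
  is_presentation (val : S -> W) coxeter_rel.

Definition universal_type : Prop :=
  forall s t, S s -> S t -> s <> t -> order_of (s * t) = 0%N.

Definition len (w : W) : nat :=
  least [set n | exists l : seq W,
    [/\ size l = n, [set` l] `<=` S & \prod_(s <- l) s = w]].

Definition translate (v : W) (A : set W) : set W := [set v * x | x in A].

Definition simple_root (s : W) : set W := [set w | (len w < len (s * w))%N].

Definition root (a : set W) : Prop :=
  exists v s, S s /\ a = translate v (simple_root s).

Definition pos_root (a : set W) : Prop := root a /\ a 1.

Definition prenilpotent (a b : set W) : Prop :=
  (a `&` b) !=set0 /\ (~` a `&` ~` b) !=set0.

Definition closed_interval (a b : set W) : set (set W) :=
  [set c | [/\ root c, a `&` b `<=` c & ~` a `&` ~` b `<=` ~` c]].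

(* Meaningful for prenilpotent pairs only; it is only ever applied to pairs of
   roots in some [Phi w], which are prenilpotent by [Phi_prenilpotent]. *)
Definition open_interval (a b : set W) : set (set W) :=
  closed_interval a b `\` [set a; b].

Definition gallery (c : seq W) : Prop :=
  c != [::] /\ sorted [rel x y | x^-1 * y \in S] c.

Definition gtype (c : seq W) : seq W :=
  pairmap (fun x y => x^-1 * y) (head 1 c) (behead c).

Definition minimal_gallery (c : seq W) : Prop :=
  gallery c /\ len ((head 1 c)^-1 * last 1 c) = (size c).-1.

Definition crossed_root (x y : W) : set W :=
  xget set0 [set a | [/\ root a, a x & ~ a y]].

Definition crossing (c : seq W) : seq (set W) :=
  pairmap crossed_root (head 1 c) (behead c).

Definition gallery_between (a b : set W) (c : seq W) : Prop :=
  [/\ minimal_gallery c, ohead (crossing c) = Some a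
    & ohead (rev (crossing c)) = Some b].

Definition Min : set (seq W) :=
  [set G | minimal_gallery G /\ ohead G = Some 1].

Definition Min_to (w : W) : set (seq W) := [set G | Min G /\ last 1 G = w].

Definition left_descent (s w : W) : bool := (len (s * w)).+1 == len w.

Definition Min_from (s w : W) : set (seq W) :=
  [set G | Min_to w G /\ (left_descent s w -> ohead (gtype G) = Some s)].

Definition gallery_act (s w : W) (G : seq W) : seq W :=
  if left_descent s w then [seq s * c | c <- behead G]
  else 1 :: [seq s * c | c <- G].

Definition Phi (w : W) : set (set W) := [set a | pos_root a /\ ~ a w].

Lemma Phi_prenilpotent (w : W) (a b : set W) :
  Phi w a -> Phi w b -> prenilpotent a b.
Proof. by move=> [[_ a1] aw] [[_ b1] bw]; split; [exists 1 | exists w]. Qed.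

Definition gallery_le (G : seq W) (a b : set W) : Prop :=
  [/\ a \in crossing G, b \in crossing G
    & (index a (crossing G) <= index b (crossing G))%N].

Definition blueprint_index (G : seq W) (a b : set W) : Prop :=
  [/\ Min G, pos_root a, pos_root b & gallery_le G a b].

(* A family indexed by [blueprint_index] is represented by a total function;
   its values outside of [blueprint_index] are never used. *)
Definition root_family := seq W -> set W -> set W -> set (set W).

Variable M : root_family.

(* The elements of [M G a b], listed in increasing order for [gallery_le G]. *)
Definition ordered_roots (G : seq W) (a b : set W) : seq (set W) :=
  [seq c <- crossing G | c \in M G a b].

(* [pmap insub] only retypes the roots in [Phi w]. *)
Definition U_rel (w : W) (u v : word (Phi w)) : Prop :=
  (exists a : Phi w, u = letters [:: a; a] /\ v = [::]) \/
  (exists G (a b : Phi w),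
     [/\ Min_to w G, blueprint_index G (val a) (val b), u = comm_word a b
       & v = letters (pmap insub (ordered_roots G (val a) (val b)))]).

Definition U (w : W) : groupType := presented_group (@U_rel w).

Definition CB1 : Prop :=
  forall (G : seq W) (m : nat) (a b : set W),
    Min G -> (1 <= m)%N -> (m < size G)%N ->
    gallery_le (take m.+1 G) a b -> M (take m.+1 G) a b = M G a b.

Definition longest_in (A : set W) (r : W) : Prop :=
  A r /\ forall v, A v -> (len v <= len r)%N.

Definition CB2 : Prop :=
  forall (s t r : W) (G : seq W) (a b : set W),
    S s -> S t -> s <> t -> order_of (s * t) <> 0%N ->
    longest_in (generated [set s; t]) r ->
    Min_to r G -> blueprint_index G a b ->
    ([set a; b] = [set simple_root s; simple_root t] ->
       M G a b = open_interval a b) /\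
    ([set a; b] <> [set simple_root s; simple_root t] -> M G a b = set0).

Definition CB3 : Prop := forall w, ([set: U w] #= `I_(2 ^ len w))%card.

Definition commutator_blueprint : Prop :=
  [/\ forall G a b, blueprint_index G a b -> M G a b `<=` open_interval a b,
      CB1, CB2 & CB3].

Definition weyl_invariant : Prop :=
  forall (w s : W) (G : seq W) (a b : set W),
    S s -> Min_from s w G -> gallery_le G a b ->
    a <> simple_root s -> b <> simple_root s ->
    M (gallery_act s w G) (translate s a) (translate s b) =
    [set translate s c | c in M G a b].

End Coxeter.

(* The word (s, t, s, ..., t, s) with k + 1 entries s and k entries t. *)
Definition alt_type (W : Type) (s t : W) (k : nat) : seq W :=
  mkseq (fun i => if odd i then t else s) k.*2.+1.

(* The set does not depend on the gallery from the base chamber containing the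
   roots.  As [crossing c] is numbered from 0, alpha_(2j) is its entry of index
   2j - 1. *)
Definition tits (W : groupType) (S : set W) (K : set nat) (J : nat -> set nat)
    (s t : W) (a b : set W) : set (set W) :=
  [set g | exists k c j,
     [/\ K k, gallery_between S a b c, gtype c = alt_type s t k, J k j
       & g = nth set0 (crossing S c) (j.*2).-1]].

(* Main.v *)
(* Take [M G a b := T(K, J, s, t)_{a,b}] for all galleries [G], not only those in
   the {s, t}-residue.  This is invariant under translation, and only (CB3) needs
   an argument.  The chamber graph of a universal Coxeter group is a tree, so a
   root is a half-tree and has a well-defined type, that of its boundary edge.
   All elements of [M G a b] have type [t], and [M G a b] is empty unless [a] and
   [b] both have type [s].  Hence in [U w] the generators of type [t] are central
   and [U w] is nilpotent of class at most 2: collection bounds its order by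
   2^(len w), and the central extension of F_2^(len w) by the cocycle read off
   from [M] shows that the bound is attained. *)
Require Import Defs.
From mathcomp Require Import all_boot.
From mathcomp Require Import boolp classical_sets functions cardinality zify.

Set Implicit Arguments.
Unset Strict Implicit.
Unset Printing Implicit Defensive.

Local Open Scope classical_set_scope.
Local Open Scope group_scope.

(** * Words as products in a presented group *)

Lemma prod_letters (X : choiceType) (R : word X -> word X -> Prop) (l : seq X) :
  pg_class R (letters l) =
  \prod_(x <- l) (pg_class R [:: (x, false)] : presented_group R).
Proof.
elim: l => [|x l IHl]; first by rewrite big_nil.
by rewrite big_cons -IHl; apply/esym/(pg_class_cat R [:: (x, false)]).
Qed.

(** * Collection when commutators of generators are products of central generators *)

Section Collection.
Variables (G : groupType) (X : eqType) (h : X -> G) (Z : pred X).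
Hypothesis hh : forall x, h x * h x = 1.
Hypothesis hZ : forall p x, Z p -> commute (h p) (h x).
Hypothesis h_comm : forall x y, exists2 l, all Z l &
  [~ h x, h y] = \prod_(p <- l) h p.

(** The bit sequence [m] is the vector of exponents in F_2: each entry of [l] is used at most once,
    in the order of [l]. *)
Definition collected (l : seq X) (g : G) : Prop :=
  exists2 m : bitseq, size m = size l & \prod_(x <- mask m l) h x = g.

Lemma collected_cons y l g :
  collected (y :: l) g <->
  exists (b : bool) g', collected l g' /\ g = h y ^+ b * g'.
Proof.
split=> [[[|b m] //= [sm] <-]|[b [_ [[m sm <-] ->]]]].
  exists b, (\prod_(x <- mask m l) h x); split; first by exists m.
  by case: b; rewrite ?big_cons ?expg1 ?mul1g.
exists (b :: m); first by rewrite /= sm.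
by case: b; rewrite /= ?big_cons ?expg1 ?mul1g.
Qed.

Lemma collected_head x l g : collected (x :: l) g -> collected (x :: l) (h x * g).
Proof.
move=> /collected_cons[b [g' [lg' ->]]].
apply/collected_cons; exists (~~ b), g'; split=> //.
by case: b; rewrite /= ?expg1 ?mul1g // mulgA hh mul1g.
Qed.

(** A central generator travels freely to its place in [l], where it toggles the exponent. *)
Lemma collected_central p l g :
  Z p -> p \in l -> collected l g -> collected l (h p * g).
Proof.
move=> Zp; elim: l g => // y l IHl g; rewrite inE.
have [<- _|_ /= pl] := eqVneq p y; first exact: collected_head.
move=> /collected_cons[b [g' [lg' ->]]].
apply/collected_cons; exists b, (h p * g'); split; first exact: IHl.
by rewrite !mulgA; congr (_ * _); apply/commuteX/hZ.
Qed.

Definition central_prod (d : G) : Prop := exists2 l, all Z l & d = \prod_(p <- l) h p.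

Lemma central_prodC d x : central_prod d -> commute d (h x).
Proof.
move=> [l /allP Zl ->]; apply: commute_sym; rewrite big_seq.
by apply: commute_prod => p /Zl Zp; apply/commute_sym/hZ.
Qed.

Lemma central_prodM c d : central_prod c -> central_prod d -> central_prod (c * d).
Proof.
move=> [k Zk ->] [l Zl ->]; exists (k ++ l); first by rewrite all_cat Zk.
by rewrite big_cat.
Qed.

Lemma central_prodV d : central_prod d -> central_prod d^-1.
Proof.
move=> [l + ->]; elim: l => [|p l IHl] /=.
  by exists [::] => //; rewrite big_nil invg1.
move=> /andP[Zp Zl]; rewrite big_cons invgM.
apply: central_prodM; first exact: IHl.
exists [:: p]; rewrite /= ?Zp // big_seq1.
exact/mulg1_eq/hh.
Qed.

Lemma collected_central_prod d l g :
  (forall p, p \in l) -> central_prod d -> collected l g -> collected l (d * g).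
Proof.
move=> lX [k + ->] lg; elim: k => [|p k IHk] /=; first by rewrite big_nil mul1g.
move=> /andP[Zp Zk]; rewrite big_cons -mulgA.
by apply: collected_central => //; apply: IHk.
Qed.

(* Moving [h x] to its place costs only central factors. *)
Lemma collected_mul_central x l g : x \in l -> collected l g ->
  exists2 d, central_prod d & collected l (d * (h x * g)).
Proof.
elim: l g => // y l IHl g; rewrite inE.
have [<- _|_ /= xl] := eqVneq x y.
  move=> lg; exists 1; first by exists [::] => //; rewrite big_nil.
  by rewrite mul1g; apply: collected_head.
move=> /collected_cons[b [g' [lg' ->]]].
have [d Dd lxg'] := IHl _ xl lg'.
(* The price of passing [h y ^+ b]: nothing for exponent 0, the commutator of [h y] and [h x] for
   exponent 1. *)
have [c Dc xyE] : exists2 c, central_prod c & c * (h x * h y ^+ b) = h y ^+ b * h x.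
  case: b; last first.
    by exists 1; rewrite /= ?mul1g ?mulg1 //; exists [::] => //; rewrite big_nil.
  exists [~ h y, h x]; first exact: h_comm.
  rewrite /= expg1 [RHS]commgC; apply: commute_sym.
  by apply: commute_sym; apply: commuteM; apply: central_prodC; apply: h_comm.
exists (d * c); first exact: central_prodM.
apply/collected_cons; exists b, (d * (h x * g')); split=> //.
rewrite (mulgA (h x) (h y ^+ b)) -(mulgA d) (mulgA c) xyE !mulgA; congr (_ * _ * _).
by apply: commuteX; apply: central_prodC.
Qed.

(** The central error [d] is cancelled by multiplying with its inverse, which is again a product of
    central generators and so keeps the element collected. *)
Lemma collected_mul x l g :
  (forall p, p \in l) -> collected l g -> collected l (h x * g).
Proof.
move=> lX lg; have [d Dd] := collected_mul_central (lX x) lg.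
move=> /(collected_central_prod lX (central_prodV Dd)).
by rewrite mulgA mulVg mul1g.
Qed.

Lemma collected_prod k l : (forall p, p \in l) -> collected l (\prod_(x <- k) h x).
Proof.
move=> lX; elim: k => [|x k IHk]; last by rewrite big_cons; apply: collected_mul.
exists (nseq (size l) false); first by rewrite size_nseq.
by rewrite big_nil mask_false big_nil.
Qed.

End Collection.

(** * Order of a group of class at most two given by commutator relations *)

Section ClassTwoPresentation.
Variables (X : choiceType) (e : seq X) (M : X -> X -> pred X) (Z : pred X).
Variable R : word X -> word X -> Prop.
Hypotheses (e_uniq : uniq e) (eX : forall x, x \in e).
Hypothesis M_central : forall a b p, M a b p -> [/\ Z p, ~~ Z a & ~~ Z b].
Hypothesis Mxx : forall a p, M a a p = false.
Hypothesis RE : forall u v, R u v <->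
  (exists a, u = letters [:: a; a] /\ v = [::]) \/
  (exists a b, [/\ index a e <= index b e, u = comm_word a b &
                   v = letters [seq p <- e | M a b p]]).

Let before (x y : X) := index x e < index y e.

(** The cocycle of the extension. Moving [x] rightwards to its place in the ordered product over [f]
    passes every factor [y] before [x], and each passage contributes [M y x p] to the exponent of
    [p]. *)
Definition twist (x : X) (f : pred X) : pred X := fun p =>
  \big[addb/false]_(y <- e) [&& f y, before y x & M y x p].

(* Left multiplication by the generator [x] on the central extension of the
   elementary abelian group of subsets of [X], in the coordinates [pred X]. *)
Definition gen_act (x : X) (f : pred X) : pred X := fun p =>
  f p (+) (p == x) (+) twist x f p.

Definition word_act (u : word X) (f : pred X) : pred X :=
  foldr (fun c => gen_act c.1) f u.

Lemma word_act_cat u v f : word_act (u ++ v) f = word_act u (word_act v f).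
Proof. exact: foldr_cat. Qed.

Lemma twist_central x f p : ~~ Z p || Z x -> twist x f p = false.
Proof.
move=> Zpx; apply: big1 => y _; apply/and3P => -[_ _ /M_central[Zp _ Zx]].
by rewrite Zp (negPf Zx) in Zpx.
Qed.

(** Acting by [y] changes [f] at [y] and in central coordinates. The latter are invisible to
    [twist x], since [M z x] is empty for central [z]; so only the toggle at [y] counts. *)
Lemma twist_gen_act x y f p :
  twist x (gen_act y f) p = twist x f p (+) (before y x && M y x p).
Proof.
transitivity (\big[addb/false]_(z <- e)
    ([&& f z, before z x & M z x p] (+) [&& z == y, before z x & M z x p])).
  apply: eq_bigr => z _; rewrite -andb_addl /gen_act.
  have [/andP[_ /M_central[_ Zz _]]|] := boolP (before z x && M z x p); last first.
    by rewrite !andbF.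
  by rewrite twist_central ?Zz // addbF.
rewrite big_split /= -/(twist x f p); congr (_ (+) _).
rewrite (bigD1_seq y) //= eqxx big1 ?addbF // => z /negPf->.
by [].
Qed.

Lemma gen_actK x : involutive (gen_act x).
Proof.
move=> f; apply/funext => p; rewrite {1}/gen_act twist_gen_act /before ltnn addbF.
by rewrite /gen_act; case: (f p); case: (p == x); case: (twist x f p).
Qed.

Lemma word_act_comm a b f p : index a e <= index b e ->
  word_act (comm_word a b) f p = f p (+) M a b p.
Proof.
move=> le_ab; rewrite /comm_word /= /gen_act -!/(gen_act _ _) !twist_gen_act.
rewrite /gen_act /before !ltnn ltnNge le_ab /= !addbF.
(* [before] is strict while the relations include the pair [a = b]; there [Mxx] makes both sides
   false. *)
have ->: (index a e < index b e) && M a b p = M a b p.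
  rewrite ltn_neqAle le_ab andbT; case: eqP => //= ab.
  have -> : a = b by rewrite -[a](nth_index a (eX a)) ab nth_index.
  by rewrite Mxx.
by case: (f p); case: (p == a); case: (p == b); case: (twist a f p);
  case: (twist b f p); case: (M a b p).
Qed.

Lemma word_act_central l f p : all Z l -> uniq l ->
  word_act (letters l) f p = f p (+) (p \in l).
Proof.
elim: l => [|x l IHl] /=; first by rewrite addbF.
move=> /andP[Zx Zl] /andP[xl ul]; rewrite {1}/gen_act twist_central ?Zx ?orbT //.
rewrite IHl // inE addbF; have [->|] := eqVneq p x; last by rewrite addbF.
by rewrite (negPf xl) addbF.
Qed.

(** The defining relations hold in the model, so the presented group acts on [pred X]; this action
    yields the lower bound for its order. *)
Lemma word_act_eq u v : word_eq R u v -> word_act u = word_act v.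
Proof.
elim=> {u v} [//|//|u v w _ -> //|u u' v v' _ uu' _ vv'|x b|u v].
- by apply/funext => f; rewrite !word_act_cat uu' vv'.
- by apply/funext => f; apply: gen_actK.
case/RE => [[a [-> ->]]|[a [b [ab -> ->]]]].
  by apply/funext => f; apply: gen_actK.
apply/funext => f; apply/funext => p; rewrite word_act_comm //.
rewrite word_act_central ?filter_uniq ?mem_filter ?eX ?andbT //.
by apply/allP => q; rewrite mem_filter => /andP[/M_central[]].
Qed.

(** The last letter acts first, so each new letter precedes all those already present and no twist
    arises. *)
Lemma word_act_sorted l : pairwise before l ->
  word_act (letters l) pred0 = (fun p => p \in l).
Proof.
elim: l => [|x l IHl] //= /andP[/allP xl /IHl l_act].
apply/funext => p; rewrite l_act /gen_act inE [twist _ _ _]big1; last first.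
  move=> y _; apply/and3P => -[/xl + yx _].
  by rewrite /before ltnNge ltnW.
rewrite addbF addbC; case: eqVneq => // ->.
by case: (boolP (x \in l)) => // /xl; rewrite /before ltnn.
Qed.

Lemma pairwise_before : pairwise before e.
Proof.
rewrite -(pairwise_map (index^~ e) ltn).
have -> : map (index^~ e) e = iota 0 (size e).
  case E : e => [//|x0 s]; rewrite -E; apply: (@eq_from_nth _ 0).
    by rewrite size_map size_iota.
  move=> i; rewrite size_map => ie.
  by rewrite (nth_map x0) // index_uniq // nth_iota.
by rewrite -sorted_pairwise ?iota_ltn_sorted //; apply: ltn_trans.
Qed.

Definition collect (m : bitseq) : presented_group R := pg_class R (letters (mask m e)).

(** Applying a collected element to the empty subset [pred0] returns the set of its letters, from
    which the mask is read off. *)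
Lemma collect_inj (m n : (size e).-tuple bool) : collect m = collect n -> m = n.
Proof.
move=> /pg_classP/word_act_eq mn.
have {mn} := congr1 (fun a : pred X -> pred X => a pred0) mn.
rewrite !word_act_sorted ?(subseq_pairwise (mask_subseq _ _) pairwise_before) //.
move=> mn; apply/val_inj/(@eq_from_nth _ false); rewrite !size_tuple // => i ie.
have x0 : X by case: (e) ie.
have := congr1 (fun q : pred X => q (nth x0 e i)) mn; rewrite /= !in_mask //.
by rewrite mem_nth // index_uniq.
Qed.

Let gen (x : X) : presented_group R := pg_class R [:: (x, false)].

Lemma gen_sqr x : gen x * gen x = 1.
Proof.
rewrite [LHS](pg_class_cat R [:: (x, false)] [:: (x, false)]).
by apply/pg_classP/word_eq_rel/RE; left; exists x.
Qed.

Lemma gen_comm a b : index a e <= index b e ->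
  [~ gen a, gen b] = \prod_(p <- [seq p <- e | M a b p]) gen p.
Proof.
move=> ab; rewrite -prod_letters.
have -> : [~ gen a, gen b] = pg_class R (comm_word a b).
  rewrite commgEl conjgE.
  have genV x : (gen x)^-1 = pg_class R [:: (x, true)] by apply: pg_class_inv.
  rewrite !genV [X in _ * (_ * X)]pg_class_cat [X in _ * X]pg_class_cat.
  exact: pg_class_cat.
by apply/pg_classP/word_eq_rel/RE; right; exists a, b.
Qed.

(** [M] has no values at a pair with a central member, so the relation for [p] and [x], in whichever
    order it is given, says that they commute. *)
Lemma gen_central p x : Z p -> commute (gen p) (gen x).
Proof.
move=> Zp; apply/commgP/eqP; have [px|/ltnW xp] := leqP (index p e) (index x e).
  rewrite gen_comm // big_filter big1 // => q /M_central[_].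
  by rewrite Zp.
rewrite -invgR gen_comm // big_filter big1 ?invg1 // => q /M_central[_ _].
by rewrite Zp.
Qed.

Lemma collect_surj g : exists m : (size e).-tuple bool, collect m = g.
Proof.
have [u ->] := pg_class_surj g.
have gen_commE x y : exists2 l, all Z l & [~ gen x, gen y] = \prod_(p <- l) gen p.
  (* Relations are given only for pairs in the order of [e]; the commutator of a reversed pair is an
     inverse, hence again a product of central generators. *)
  wlog xy : x y / index x e <= index y e => [hw|].
    have [/hw //|/ltnW/hw[l Zl]] := leqP (index x e) (index y e).
    move=> /(congr1 (fun z => z^-1)); rewrite invgR => ->.
    have [k Zk ->] := @central_prodV _ _ gen Z gen_sqr _ (ex_intro2 _ _ l Zl erefl).
    by exists k.
  exists [seq p <- e | M x y p]; last exact: gen_comm.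
  by apply/allP => p; rewrite mem_filter => /andP[/M_central[]].
have [m sm mu] := collected_prod gen_sqr gen_central gen_commE (map fst u) eX.
exists (Tuple (introT eqP sm)); rewrite /collect prod_letters /= mu -prod_letters.
(* It remains to see that dropping the signs of [u] leaves its class unchanged, the generators being
   involutions. *)
elim: u {m sm mu} => // -[x b] u IHu.
have consE c v : pg_class R (c :: v) = pg_mul (pg_class R [:: c]) (pg_class R v).
  by rewrite pg_class_cat.
rewrite /= [LHS]consE [RHS]consE -IHu; congr pg_mul.
case: b => //; rewrite -[LHS](mulg1_eq (gen_sqr x)).
exact: pg_class_inv.
Qed.

Lemma card_class_two : ([set: presented_group R] #= `I_(2 ^ size e))%card.
Proof.
have -> : [set: presented_group R] =
    (fun m : (size e).-tuple bool => collect m) @` setT.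
  by apply/seteqP; split=> // g _; have [m <-] := collect_surj g; exists m.
apply: (card_eq_trans (inj_card_eq _)); first by move=> m n _ _ /collect_inj.
rewrite -[2]card_bool -card_tuple.
apply: card_esym; apply: (card_eq_trans card_II).
have -> : [set: (size e).-tuple bool] =
    (fun i : 'I_#|{: (size e).-tuple bool}| => enum_val i) @` setT.
  by apply/seteqP; split=> // m _; exists (enum_rank m); rewrite ?enum_rankK.
by apply/card_esym/inj_card_eq => i j _ _ /enum_val_inj.
Qed.

End ClassTwoPresentation.

(** * Least elements and filtered lists in a subtype *)

Lemma least_eq (P : set nat) n : P n -> (forall m, P m -> n <= m) -> least P = n.
Proof.
move=> Pn n_min; apply: xget_unique => // m [Pm m_min].
by apply/eqP; rewrite eqn_leq n_min // m_min.
Qed.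

Lemma pmap_insub_filter (T : eqType) (P Q : pred T) (sT : subType P) (l : seq T) :
  pmap insub (filter Q l) = [seq x <- pmap insub l | Q (val x)] :> seq sT.
Proof.
elim: l => //= x l IHl; case: ifP => Qx /=; rewrite IHl;
  by case: insubP => //= u _ ->; rewrite Qx.
Qed.

(** * Normal forms and length in a universal Coxeter group *)

Section UniversalCoxeter.
Variables (W : groupType) (S : set W).
Hypotheses (hW : coxeter_system S) (huniv : universal_type S).

Let letter (s : W) : bool := s \in S.

Definition reduced (l : seq W) : bool := sorted [rel x y | x != y] l.

(** Left multiplication by [s], carried out on reduced words. *)
Definition push (s : W) (l : seq W) : seq W :=
  if l is t :: l' then if s == t then l' else s :: l else [:: s].

Lemma push_reduced s l : reduced l -> reduced (push s l).
Proof.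
case: l => //= t l; have [_|st] := eqVneq s t; last by rewrite /= st.
exact: path_sorted.
Qed.

Lemma pushK s l : reduced l -> push s (push s l) = l.
Proof.
case: l => [_|t l] /=; first by rewrite eqxx.
have [<-|st _] := eqVneq s t; last by rewrite /= eqxx.
by case: l => //= u l /andP[/negPf->].
Qed.

Lemma push_letters s l : letter s -> all letter l -> all letter (push s l).
Proof.
case: l => [|t l] /= Ss; first by rewrite Ss.
by case: eqP => _ /= /andP[St Sl]; rewrite ?Ss ?St.
Qed.

Lemma size_push s l : size (push s l) <= (size l).+1.
Proof. by case: l => //= t l; case: eqP => _ //=; apply: leqW. Qed.

Lemma size_foldr_push l : size (foldr push [::] l) <= size l.
Proof. by elim: l => //= s l IHl; apply: leq_trans (size_push _ _) _. Qed.

Lemma foldr_push_reduced l : reduced (foldr push [::] l).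
Proof. by elim: l => //= s l; apply: push_reduced. Qed.

Lemma foldr_push_letters l : all letter l -> all letter (foldr push [::] l).
Proof. by elim: l => //= s l IHl /andP[Ss /IHl]; apply: push_letters. Qed.

Lemma foldr_push_id l : reduced l -> foldr push [::] l = l.
Proof.
elim: l => //= s [|t l] // IHl /andP[/negPf st red]; rewrite IHl //=.
by rewrite st.
Qed.

(** A cancellation shortens the word, and this loss is never made up because [push] adds at most one
    letter per step. *)
Lemma reduced_size l : size (foldr push [::] l) = size l -> reduced l.
Proof.
elim: l => //= s l IHl sz.
have red : reduced l.
  apply/IHl/eqP; rewrite eqn_leq size_foldr_push -ltnS -sz.
  exact: size_push.
move: sz; rewrite foldr_push_id //; case: l red {IHl} => //= t l -> /=.
by case: eqP => // _ sz; lia.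
Qed.

Lemma generator_sqr s : S s -> s * s = 1.
Proof.
move=> /(proj1 hW); rewrite /order_of /least.
by case: xgetP => // _ -> [[_ +] _] s2; rewrite s2 expg2.
Qed.

Lemma generatorV s : S s -> s^-1 = s.
Proof. by move/generator_sqr/mulg1_eq. Qed.

Lemma prod_push s l : S s -> \prod_(x <- push s l) x = s * \prod_(x <- l) x.
Proof.
move=> Ss; case: l => [|t l] /=; first by rewrite big_seq1 big_nil mulg1.
have [<-|_] := eqVneq s t; last by rewrite big_cons.
by rewrite big_cons mulgA generator_sqr // mul1g.
Qed.

Lemma prod_foldr_push l : all letter l ->
  \prod_(x <- foldr push [::] l) x = \prod_(x <- l) x.
Proof.
elim: l => //= s l IHl /andP[Ss Sl]; rewrite big_cons -IHl // prod_push //.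
by rewrite inE in Ss.
Qed.

Definition word_push (u : word S) (l : seq W) : seq W :=
  foldr (fun c => push (val c.1)) l u.

Lemma word_push_reduced u l : reduced l -> reduced (word_push u l).
Proof. by move=> red; elim: u => //= c u; apply: push_reduced. Qed.

(** For [s != t] the order is encoded by 0 and the relator is the empty word; for [s = t] it
    consists of squares, which act trivially by [pushK]. *)
Lemma word_push_eq u v : word_eq (@coxeter_rel W S) u v ->
  forall l, reduced l -> word_push u l = word_push v l.
Proof.
elim=> {u v} [//|u v _ uv l red|u v w _ uv _ vw l red|u u' v v' _ uu' _ vv' l red|
  x b l red|u v [s [t [-> ->]]] l red].
- by rewrite uv.
- by rewrite uv // vw.
- rewrite /word_push !foldr_cat -!/(word_push _ _) vv' // uu' //.
  exact: word_push_reduced.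
- exact: pushK.
have [->|/eqP st] := eqVneq s t.
  elim: (order_of _) => //= n IHn; rewrite IHn; exact: pushK.
rewrite huniv //; [exact: set_valP | exact: set_valP | by move/val_inj].
Qed.

(** Uniqueness of normal forms by van der Waerden's argument: a word applied to the empty word gives
    its reduction, and the action depends only on the group element. *)
Lemma foldr_push_prod l k : all letter l -> all letter k ->
  \prod_(x <- l) x = \prod_(x <- k) x -> foldr push [::] l = foldr push [::] k.
Proof.
have lift j : all letter j -> exists i : seq S, map val i = j.
  elim: j => [|s j IHj] /=; first by exists [::].
  move=> /andP[Ss /IHj[i <-]]; rewrite inE in Ss.
  by exists (SigSub (mem_set Ss) :: i).
move=> /lift[{}l <-] /lift[{}k <-] lk.
have /(proj2 (proj2 hW)) : word_eval (val : S -> W) (letters l) =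
    word_eval val (letters k).
  by rewrite /word_eval /letters !big_map /= -!(big_map val xpredT id).
move=> /word_push_eq/(_ [::] isT).
by rewrite /word_push !foldr_map.
Qed.

Definition nf (w : W) : seq W :=
  xget [::] [set l | [/\ all letter l, reduced l & \prod_(x <- l) x = w]].

Lemma nfP w : [/\ all letter (nf w), reduced (nf w) & \prod_(x <- nf w) x = w].
Proof.
suff : exists l, [/\ all letter l, reduced l & \prod_(x <- l) x = w].
  exact: (@xgetPex _ [::] [set l | _]).
have [u <-] := proj1 (proj2 hW) w.
have Su : all letter [seq val c.1 | c <- u].
  by apply/allP => _ /mapP[c _ ->]; rewrite /letter inE; apply: set_valP.
exists (foldr push [::] [seq val c.1 | c <- u]); split.
- exact: foldr_push_letters.
- exact: foldr_push_reduced.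
rewrite prod_foldr_push // /word_eval big_map; apply: eq_bigr => c _.
by case: ifP => // _; rewrite generatorV //; apply: set_valP.
Qed.

Lemma nf_letters w : all letter (nf w). Proof. by have [] := nfP w. Qed.
Lemma nf_reduced w : reduced (nf w). Proof. by have [] := nfP w. Qed.
Lemma nf_prod w : \prod_(x <- nf w) x = w. Proof. by have [] := nfP w. Qed.

Lemma nf_unique l : all letter l -> reduced l -> nf (\prod_(x <- l) x) = l.
Proof.
move=> Sl red; have [Sn rn nE] := nfP (\prod_(x <- l) x).
by have := foldr_push_prod Sn Sl nE; rewrite !foldr_push_id.
Qed.

Lemma nf1 : nf 1 = [::].
Proof. by have := @nf_unique [::] isT isT; rewrite big_nil. Qed.

Lemma nf_mul s w : S s -> nf (s * w) = push s (nf w).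
Proof.
move=> Ss; rewrite -{1}(nf_prod w) -prod_push // nf_unique ?push_reduced ?nf_reduced //.
by apply: push_letters; rewrite ?nf_letters // /letter inE.
Qed.

Lemma nf_generator s : S s -> nf s = [:: s].
Proof. by move=> Ss; rewrite -[s in LHS]mulg1 nf_mul // nf1. Qed.

Lemma len_prod l : all letter l -> len S (\prod_(x <- l) x) = size (foldr push [::] l).
Proof.
move=> Sl; apply: least_eq.
  exists (foldr push [::] l); split=> //; last exact: prod_foldr_push.
  by move=> s /(allP (foldr_push_letters Sl)); rewrite /letter inE.
move=> _ [k [<- Sk kl]]; rewrite -(@foldr_push_prod k l) //; first exact: size_foldr_push.
by apply/allP => s /Sk; rewrite /letter inE.
Qed.

Lemma lenE w : len S w = size (nf w).
Proof.
by rewrite -{1}(nf_prod w) len_prod ?nf_letters // foldr_push_id ?nf_reduced.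
Qed.

Lemma simple_rootE s w : S s -> simple_root S s w <-> ohead (nf w) <> Some s.
Proof.
move=> Ss; rewrite /simple_root /= !lenE nf_mul //; case: (nf w) => [//|t l] /=.
have [<-|st] := eqVneq s t.
  by split=> [|//]; rewrite ltnNge leqW.
by split=> // _ [ts]; rewrite ts eqxx in st.
Qed.

(** * Roots as half-trees *)

Lemma mem_translate v (A : set W) x : translate v A x <-> A (v^-1 * x).
Proof.
split=> [[y Ay <-]|Avx]; first by rewrite mulKg.
by exists (v^-1 * x) => //; rewrite mulVKg.
Qed.

Lemma translateM u v (A : set W) : translate u (translate v A) = translate (u * v) A.
Proof.
by apply/seteqP; split=> x; rewrite !mem_translate invgM mulgA.
Qed.

(* The half-tree containing [x] whose boundary edge is [{x, x * s}]. *)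
Local Notation half x s := (translate x (simple_root S s)).

Lemma half_root x s : S s -> Defs.root S (half x s).
Proof. by move=> Ss; exists x, s. Qed.

Lemma half_base x s : S s -> half x s x.
Proof. by move=> Ss; apply/mem_translate/simple_rootE; rewrite // mulVg nf1. Qed.

Lemma half_opposite x s : S s -> ~ half x s (x * s).
Proof.
move=> Ss /mem_translate/(simple_rootE _ Ss); rewrite mulKg nf_generator //; apply.
Qed.

(** The boundary edge is the only edge leaving a half-tree. Right multiplication by [r] alters the
    normal form of [v^-1 * x] only at its end, so its first letter can become [s] only if
    [v^-1 * x = 1] and [r = s]. *)
Lemma half_edge v s x r : S s -> S r ->
  half v s x -> ~ half v s (x * r) -> x = v /\ s = r.
Proof.
move=> Ss Sr /mem_translate/(simple_rootE _ Ss) hd.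
rewrite mem_translate simple_rootE // mulgA => /contrapT.
move: hd; set y := v^-1 * x.
have := nf_letters y; have := nf_reduced y; have := nf_prod y.
case/lastP E: (nf y) => [|l q].
  rewrite big_nil => y1 _ _ _; rewrite -y1 mul1g nf_generator //= => -[rs].
  by split=> //; rewrite -[LHS](mulVKg v) -/y -y1 mulg1.
have red_l : reduced (rcons l q) -> reduced l.
  by rewrite /reduced; case: (l) => //= ? ?; rewrite rcons_path => /andP[].
rewrite -{1}cats1 big_cat big_seq1 /= all_rcons => <- red /andP[Sq Sl] hd.
have [qr|qr] := eqVneq q r.
  rewrite qr -mulgA generator_sqr // mulg1 nf_unique //; last exact: red_l red.
  by case: l hd {E red_l red Sl}.
have red' : reduced (rcons (rcons l q) r).
  move: red; rewrite /reduced; case: (l) => [|u k] /=; first by rewrite qr.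
  by rewrite !rcons_path last_rcons /= qr andbT.
have Sr' : letter r by rewrite /letter inE.
have -> : (\prod_(i <- l) i * q * r) = \prod_(i <- rcons (rcons l q) r) i.
  by rewrite -!cats1 !big_cat !big_seq1.
by rewrite nf_unique ?all_rcons ?Sr' ?Sq //; case: l hd {E red red' red_l Sl}.
Qed.

(** This makes the type of a root well defined. *)
Lemma half_inj v s x r : S s -> S r -> half v s = half x r -> v = x /\ s = r.
Proof.
move=> Ss Sr E; have vx : half v s x by rewrite E; apply: half_base.
have vxr : ~ half v s (x * r) by rewrite E; apply: half_opposite.
by have [-> ->] := half_edge Ss Sr vx vxr.
Qed.

Lemma crossed_rootE x s : S s -> crossed_root S x (x * s) = half x s.
Proof.
move=> Ss; apply: xget_unique.
  by split; [apply: half_root | apply: half_base | apply: half_opposite].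
by move=> _ [[v [r [Sr ->]]] vx vxs]; have [-> ->] := half_edge Sr Ss vx vxs.
Qed.

Lemma half_nested x s t : S s -> S t -> s != t -> half x s `<=` half (x * s) t.
Proof.
move=> Ss St /negPf st z; rewrite !mem_translate !simple_rootE // invgM.
rewrite -mulgA (generatorV Ss) (nf_mul _ Ss).
case: (nf _) => [|u l] /= su; first by case=> ts; rewrite ts eqxx in st.
have [su'|_] := eqVneq s u; first by rewrite su' in su.
by case=> ts; rewrite ts eqxx in st.
Qed.

(** * Half-trees crossed along a word *)

Fixpoint halves (x : W) (l : seq W) : seq (set W) :=
  if l is s :: l' then half x s :: halves (x * s) l' else [::].

Lemma size_halves x l : size (halves x l) = size l.
Proof. by elim: l x => //= s l IHl x; rewrite IHl. Qed.

Lemma nth_halves x l i : i < size l ->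
  nth set0 (halves x l) i = half (x * \prod_(s <- take i l) s) (nth 1 l i).
Proof.
elim: l x i => // s l IHl x [|i] /= il; first by rewrite big_nil mulg1.
by rewrite IHl // big_cons mulgA.
Qed.

Lemma halves_translate v x l : halves (v * x) l = map (translate v) (halves x l).
Proof. by elim: l x => //= s l IHl x; rewrite translateM -IHl mulgA. Qed.

Lemma halves_root x l a : all letter l -> a \in halves x l -> Defs.root S a.
Proof.
elim: l x => //= s l IHl x /andP[/set_mem Ss Sl].
by rewrite inE => /orP[/eqP->|/IHl]; [apply: half_root | apply].
Qed.

Lemma halves_nested x s l a : all letter (s :: l) -> reduced (s :: l) ->
  a \in halves (x * s) l -> half x s `<=` a.
Proof.
elim: l x s => //= t l IHl x s /and3P[/set_mem Ss St Sl] /andP[st red].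
have Tt := set_mem St; rewrite inE => /orP[/eqP->|al].
  exact: half_nested.
move=> z /(half_nested Ss Tt st); apply: IHl al z => //=.
by rewrite St.
Qed.

Lemma halves_sub_last x l a : all letter l -> reduced l ->
  a \in halves x l -> a `<=` last set0 (halves x l).
Proof.
elim: l x => // s [|t l] IHl x Sl red; first by rewrite inE => /eqP->.
have /= /andP[_ red'] := red; have /= /andP[_ Sl'] := Sl.
rewrite [halves _ _]/= inE => /orP[/eqP->|]; last exact: IHl.
by apply: (halves_nested Sl red); apply: mem_last.
Qed.

Lemma halves_start x l a : all letter l -> reduced l -> a \in halves x l -> a x.
Proof.
case: l => //= s l Sl red; have /andP[/set_mem Ss _] := Sl.
rewrite inE => /orP[/eqP->|/(halves_nested Sl red)]; first exact: half_base.
by apply; apply: half_base.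
Qed.

(** All half-trees along [l] lie in the last one, so it suffices that the last one misses the final
    chamber. *)
Lemma halves_end x l a : all letter l -> reduced l -> a \in halves x l ->
  ~ a (x * \prod_(s <- l) s).
Proof.
move=> Sl red /(halves_sub_last Sl red) sub /sub {sub a}.
elim: l x Sl red => [|s [|t l] IHl] x; first by [].
  by rewrite big_seq1 /= => /andP[/set_mem Ss _] _; apply: half_opposite.
move=> /= /andP[_ Sl] /andP[_ red]; rewrite big_cons mulgA.
exact: IHl.
Qed.

Lemma halves_uniq x l : all letter l -> reduced l -> uniq (halves x l).
Proof.
elim: l x => //= s l IHl x /andP[/set_mem Ss Sl] /path_sorted red.
rewrite IHl // andbT; apply/negP => /(halves_start Sl red).
exact: half_opposite.
Qed.

(** A path from inside a root to outside must leave it at some step, and by [half_edge] that step is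
    its boundary edge. *)
Lemma mem_halves x l a : all letter l -> Defs.root S a ->
  a x -> ~ a (x * \prod_(s <- l) s) -> a \in halves x l.
Proof.
move=> + [v [r [Sr ->]]]; elim: l x => [|s l IHl] x /=.
  by rewrite big_nil mulg1.
move=> /andP[/set_mem Ss Sl] ax; rewrite big_cons mulgA inE => end_l.
have [axs|axs] := pselect (half v r (x * s)); first by rewrite IHl ?orbT.
by have [<- <-] := half_edge Sr Ss ax axs; rewrite eqxx.
Qed.

Lemma mem_Phi w a : Phi S w a <-> a \in halves 1 (nf w).
Proof.
have [Sl red wE] := nfP w; split=> [[[ra a1] aw]|al].
  by apply: mem_halves; rewrite // wE mul1g.
split; last by rewrite -wE -[X in a X]mul1g; apply: halves_end al.
by split; [apply: halves_root al | apply: halves_start al].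
Qed.

(** * Minimal galleries as reduced words *)

Definition chambers (x : W) (l : seq W) : seq W := x :: scanl *%g x l.

Lemma gtype_chambers x l : gtype (chambers x l) = l.
Proof. by apply: scanlK => y s; rewrite mulKg. Qed.

Lemma last_chambers x l : last 1 (chambers x l) = x * \prod_(s <- l) s.
Proof.
rewrite /=; elim: l x => [|s l IHl] x /=; first by rewrite big_nil mulg1.
by rewrite IHl big_cons mulgA.
Qed.

Lemma gallery_chambersP c : gallery S c <->
  exists x l, all letter l /\ c = chambers x l.
Proof.
have pathE x p : path [rel y z | y^-1 * z \in S] x p =
    all letter (pairmap (fun y z => y^-1 * z) x p).
  by elim: p x => //= y p IHp x; rewrite IHp.
split=> [[]|[x [l [Sl ->]]]].
  case: c => // x p _; rewrite /= pathE => Sp.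
  exists x, (pairmap (fun y z => y^-1 * z) x p); split=> //.
  by rewrite /chambers pairmapK // => y z; rewrite mulVKg.
split=> //; rewrite /= pathE.
by rewrite scanlK // => y s; rewrite mulKg.
Qed.

Lemma minimal_chambersP c : minimal_gallery S c <->
  exists x l, [/\ all letter l, reduced l & c = chambers x l].
Proof.
split=> [[/gallery_chambersP[x [l [Sl ->]]]]|[x [l [Sl red ->]]]].
  rewrite last_chambers /= mulKg len_prod // size_scanl => sz.
  by exists x, l; split=> //; apply: reduced_size.
split; first by apply/gallery_chambersP; exists x, l.
by rewrite last_chambers /= mulKg len_prod // size_scanl foldr_push_id.
Qed.

Lemma crossing_chambers x l : all letter l -> crossing S (chambers x l) = halves x l.
Proof.
rewrite /crossing /=; elim: l x => //= s l IHl x /andP[/set_mem Ss Sl].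
by rewrite crossed_rootE // IHl.
Qed.

(** Geodesics in a tree are unique. *)
Lemma Min_toP w G : Min_to S w G <-> G = chambers 1 (nf w).
Proof.
split=> [[[/minimal_chambersP[x [l [Sl red ->]]] [->]] wE]|->].
  by rewrite -wE last_chambers mul1g nf_unique.
split; last by rewrite last_chambers mul1g nf_prod.
split=> //; apply/minimal_chambersP; exists 1, (nf w).
by split; [apply: nf_letters | apply: nf_reduced |].
Qed.

Lemma gallery_betweenP a b c : gallery_between S a b c <->
  exists x l, [/\ all letter l, reduced l, l != [::], c = chambers x l &
    a = head set0 (halves x l) /\ b = last set0 (halves x l)].
Proof.
have rev_last (p : seq (set W)) r : ohead (rev (r :: p)) = Some (last r p).
  by rewrite lastI rev_rcons.
split=> [[/minimal_chambersP[x [l [Sl red ->]]]]|[x [l [Sl red l0 -> [-> ->]]]]].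
  rewrite crossing_chambers // => ha hb; exists x, l; split=> //.
    by case: (l) ha.
  case: (l) ha hb => //= s k [<-]; rewrite rev_last => -[<-].
  by [].
split; first by apply/minimal_chambersP; exists x, l.
  by rewrite crossing_chambers //; case: (l) l0.
by rewrite crossing_chambers //; case: (l) l0 => //= s k _; rewrite rev_last.
Qed.

(** * The blueprint given by Tits' parameters *)

Section TitsBlueprint.
Variables (K : set nat) (J : nat -> set nat) (s t : W).
Hypothesis hJ : forall k, K k -> J k `<=` [set j | 1 <= j <= k].
Hypotheses (Ss : S s) (St : S t) (st : s <> t).

Local Notation alt k := (alt_type s t k).

Lemma size_alt k : size (alt k) = k.*2.+1.
Proof. by rewrite size_mkseq. Qed.

Lemma alt_letters k : all letter (alt k).
Proof.
by apply/allP => _ /mapP[i _ ->]; rewrite /letter inE; case: odd.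
Qed.

Lemma alt_reduced k : reduced (alt k).
Proof.
apply/(sortedP 1) => i; rewrite size_alt => ik.
rewrite (nth_mkseq _ _ ik) (nth_mkseq _ _ (ltnW ik)) /=.
by case: odd; apply/eqP => // /esym.
Qed.

Lemma titsP a b g : tits S K J s t a b g <-> exists k j x,
  [/\ K k, J k j, a = head set0 (halves x (alt k)),
      b = last set0 (halves x (alt k)) & g = nth set0 (halves x (alt k)) j.*2.-1].
Proof.
split=> [[k [c [j [Kk /gallery_betweenP[x [l [Sl _ _ -> [-> ->]]]]]]]]|].
  by rewrite gtype_chambers crossing_chambers // => -> Jj ->; exists k, j, x.
move=> [k [j [x [Kk Jj aE bE gE]]]]; exists k, (chambers x (alt k)), j; split=> //.
- apply/gallery_betweenP; exists x, (alt k).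
  by split=> //; [apply: alt_letters | apply: alt_reduced].
- exact: gtype_chambers.
by rewrite crossing_chambers // alt_letters.
Qed.

(** Counted from 0, the end roots have indices 0 and 2k, so the root numbered 2j lies strictly
    between them. *)
Lemma tits_index k j : K k -> J k j -> 0 < j.*2.-1 < k.*2.
Proof. by move=> Kk /(hJ Kk) /= /andP[]; lia. Qed.

Lemma tits_open_interval a b : tits S K J s t a b `<=` open_interval S a b.
Proof.
move=> g /titsP[k [j [x [Kk Jj -> -> ->]]]].
have := alt_letters k; have := alt_reduced k; have := size_alt k.
have /andP[j0 jk] := tits_index Kk Jj.
move: (alt k) => l sl red Sl; have sH := size_halves x l; rewrite sl in sH.
have gH : nth set0 (halves x l) j.*2.-1 \in halves x l.
  by rewrite mem_nth // sH ltnS ltnW.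
rewrite -[head _ _]nth0 -[last _ _]nth_last sH /=.
have sub_g : nth set0 (halves x l) 0 `<=` nth set0 (halves x l) j.*2.-1.
  case: l red Sl sl sH gH => // r l red Sl sl sH gH.
  apply: (halves_nested Sl red).
  by rewrite -(prednK j0) /= mem_nth // size_halves; case: sl => ->; lia.
have g_sub : nth set0 (halves x l) j.*2.-1 `<=` nth set0 (halves x l) k.*2.
  have -> : k.*2 = (size (halves x l)).-1 by rewrite sH.
  by rewrite nth_last; apply: halves_sub_last.
split.
  split; first exact: halves_root gH.
    by move=> z [/sub_g].
  by move=> z [_ bz] /g_sub.
by case=> /eqP; rewrite nth_uniq ?sH ?halves_uniq //; lia.
Qed.

Lemma titsxx a g : ~ tits S K J s t a a g.
Proof.
move=> /titsP[k [j [x [Kk Jj aE]]]]; have := tits_index Kk Jj.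
have sH := size_halves x (alt k); rewrite size_alt in sH.
rewrite {}aE -[head _ _]nth0 -[last _ _]nth_last sH => + /eqP.
by rewrite nth_uniq ?sH ?halves_uniq ?alt_letters ?alt_reduced //; lia.
Qed.

(** The indices 0 and 2k are even and 2j - 1 is odd, and [alt k] has [s] at even and [t] at odd
    positions. *)
Lemma tits_types a b g : tits S K J s t a b g ->
  exists x y z, [/\ a = half x s, b = half y s & g = half z t].
Proof.
move=> /titsP[k [j [x [Kk Jj aE bE gE]]]]; have /andP[j0 jk] := tits_index Kk Jj.
have sH := size_halves x (alt k); rewrite size_alt in sH.
move: aE bE gE; rewrite -[head _ _]nth0 -[last _ _]nth_last sH.
rewrite !nth_halves ?size_alt ?ltnS ?(ltnW jk) // !nth_mkseq ?ltnS ?(ltnW jk) //=.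
rewrite odd_double; have -> : odd j.*2.-1 by lia.
by move=> -> -> ->; do 3 eexists.
Qed.

Lemma tits_translate v a b :
  tits S K J s t (translate v a) (translate v b) =
  translate v @` tits S K J s t a b.
Proof.
have sub u c d : translate u @` tits S K J s t c d `<=`
    tits S K J s t (translate u c) (translate u d).
  move=> _ [g /titsP[k [j [x [Kk Jj -> -> ->]]]] <-]; apply/titsP.
  have /andP[j0 jk] := tits_index Kk Jj.
  exists k, j, (u * x); split=> //; rewrite halves_translate.
  - by rewrite -!nth0 (nth_map set0) // size_halves size_alt.
  - by rewrite -!nth_last size_map (nth_map set0) // size_halves size_alt.
  by rewrite (nth_map set0) // size_halves size_alt; lia.
have translate1 (c : set W) : translate 1 c = c.
  by apply/seteqP; split=> z; rewrite mem_translate invg1 mul1g.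
apply/seteqP; split; last exact: sub.
(* The reverse inclusion is [sub] applied to the inverse translation. *)
move=> g Tg; exists (translate v^-1 g); last by rewrite translateM mulgV translate1.
have := sub v^-1 (translate v a) (translate v b).
by rewrite !translateM mulVg !translate1; apply; exists g.
Qed.

Let M : root_family W := fun _ a b => tits S K J s t a b.

Lemma tits_CB3 : CB3 S M.
Proof.
(* The roots of [Phi S w], in the order in which the unique minimal gallery to [w] crosses them. *)
move=> w; pose e : seq (Phi S w) := pmap insub (halves 1 (nf w)).
have eE : map val e = halves 1 (nf w).
  rewrite /e pmap_filter; last exact: insubK.
  by apply/all_filterP/allP => a /mem_Phi Pa; rewrite insubT ?inE.
have [Sl red _] := nfP w.
have e_uniq : uniq e by rewrite -(map_inj_uniq val_inj) eE halves_uniq.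
have eX a : a \in e.
  by rewrite -(mem_map val_inj) eE; apply/mem_Phi; apply: set_valP.
have crossE G : Min_to S w G -> crossing S G = map val e.
  by move=> /Min_toP->; rewrite crossing_chambers.
have -> : len S w = size e by rewrite lenE -(size_map val) eE size_halves.
pose N (a b g : Phi S w) : bool := `[< tits S K J s t (val a) (val b) (val g) >].
(* The roots of type [t] are to be the central generators; [half_inj] keeps those of type [s] out of
   [Z]. *)
pose Z (a : Phi S w) : bool := `[< exists x, val a = half x t >].
have roots_ordered G (a b : Phi S w) : Min_to S w G ->
    pmap insub (ordered_roots S M G (val a) (val b)) = [seq g <- e | N a b g].
  move=> GE; rewrite /ordered_roots pmap_insub_filter crossE // eE.
  by apply: eq_filter => g; apply/idP/asboolP => [/set_mem|/mem_set].
apply: (@card_class_two _ e N Z) => //.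
- move=> a b g /asboolP/tits_types[x [y [z [aE bE gE]]]].
  have notZ (c : Phi S w) v : val c = half v s -> ~~ Z c.
    by move=> cE; apply/asboolPn => -[u]; rewrite cE => /(half_inj Ss St)[].
  by split; [apply/asboolP; exists z | apply: notZ aE | apply: notZ bE].
- by move=> a g; apply/asboolPn/titsxx.
move=> u v; split=> [[[a [-> ->]]|[G [a [b [GE [_ _ _ [_ _ ab]] -> ->]]]]]|].
- by left; exists a.
- right; exists a, b; split=> //; last by rewrite roots_ordered.
  by rewrite crossE // !index_map in ab; try exact: val_inj.
move=> [[a [-> ->]]|[a [b [ab -> ->]]]]; first by left; exists a.
have GE : Min_to S w (chambers 1 (nf w)) by apply/Min_toP.
right; exists (chambers 1 (nf w)), a, b; split=> //; last by rewrite roots_ordered.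
split; [by case: GE | by case: (set_valP a) | by case: (set_valP b) |].
by split; rewrite crossE // ?index_map ?map_f //; apply: val_inj.
Qed.

Lemma tits_blueprint : commutator_blueprint S M /\ weyl_invariant S M.
Proof.
(* As [M] is constant in the gallery, Weyl-invariance is just compatibility with translation. *)
split; last by move=> w r G a b _ _ _ _ _; apply: tits_translate.
(* (CB1) is trivial for the same reason, and (CB2) is vacuous because distinct generators have a
   product of infinite order. *)
split=> [G a b _|//|r q r' G a b Sr Sq rq|]; last exact: tits_CB3.
  exact: tits_open_interval.
by rewrite huniv.
Qed.

End TitsBlueprint.
End UniversalCoxeter.

Theorem theorem1 (W : groupType) (S : set W)
    (hW : coxeter_system S) (hfin : finite_set S)
    (hrank : (`I_2 #<= S)%card) (huniv : universal_type S)
    (K : set nat) (hK : K !=set0)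
    (J : nat -> set nat)
    (hJ : forall k, K k -> J k `<=` [set j | (1 <= j <= k)%N]) :
  exists M : root_family W,
    [/\ commutator_blueprint S M, weyl_invariant S M &
      exists s t : W, [/\ S s, S t, s <> t &
        forall (w : W) (G : seq W) (a b : set W),
          generated [set s; t] w -> Min_to S w G -> gallery_le S G a b ->
          M G a b = tits S K J s t a b]].
Proof.
have /card_leP[f] := hrank.
have lt2 i : i < 2 -> i \in `I_2 by move=> i2; apply: mem_set.
(* The two generators are the images of 0 and 1 under the injection provided by the rank
   hypothesis. *)
pose s := val (f (SigSub (lt2 0 isT))); pose t := val (f (SigSub (lt2 1%N isT))).
have Ss : S s := set_valP _; have St : S t := set_valP _.
have st : s <> t.
  by move=> /val_inj/(@inj _ _ _ f); rewrite !in_setT => /(_ isT isT)/(congr1 val).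
exists (fun _ a b => tits S K J s t a b).
have [] := tits_blueprint hW huniv hJ Ss St st.
by split=> //; exists s, t.
Qed.
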